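(* Fix the sample size $n$. For each dimension $d$, let $X_1,\dots,X_n$ be $n$ independent copies of $X$, which follows a $d$-dimensional non-spherical (i.e. not spherically symmetric) distribution $P$ (depending on $d$). Assume that, as $d\to\infty$, $$\mathbb{P}\left[\frac{d\,(X_1^\top X_2)^2}{\|X_1\|^2\|X_2\|^2}>M\right]\to 1\quad\text{for all } M>0 .$$ Then $S$, the vector of string signs, converges to $\mathbf{1}_n=(1,1,\dots,1)$ in probability as $d\to\infty$.
   Context: Here $d\ge 2$, $n\ge2$. A random vector $X$ in $\mathbb{R}^d$ (or its distribution) is spherically symmetric (about the origin) if $HX\stackrel{D}{=}X$ for every $d\times d$ orthogonal matrix $H$. The spherically symmetric variants of $X_1,\dots,X_n$ are $X_i'=\|X_i\|U_i$, where $U_1,\dots,U_n$ are i.i.d. uniform on the unit sphere $\mathcal{S}^{d-1}$, independent of $(X_1,\dots,X_n)$. For $x,y\in\mathbb{R}^d$ put $\theta(x,y)=\exp\{-(\frac1d x^\top y)^2\}$. For $s\in\{0,1\}$ let $Y_{s,i}=sX_i+(1-s)X_i'$. Let $\mathcal{S}_n$ be the set of permutations of $\{1,\dots,n\}$. Define $$(S,\Pi)=\arg\min_{s\in\{0,1\}^n,\ \pi\in\mathcal{S}_n}\ \sum_{i=1}^{n-1}\theta\big(Y_{s_{\pi_i},\pi_i},Y_{s_{\pi_{i+1}},\pi_{i+1}}\big).$$ A path and its reversal have equal cost; when there are several minimizers one of them is chosen uniformly at random, independently of everything else. $S=(S_1,\dots,S_n)$ is the vector of string signs. *)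

(* Defs.v *)
From HB Require Import structures.
From mathcomp Require Import all_boot all_order all_algebra all_fingroup.
From mathcomp Require Import all_classical all_reals all_analysis.

Set Implicit Arguments.
Unset Strict Implicit.
Unset Printing Implicit Defensive.

Import Order.TTheory GRing.Theory Num.Theory.
Import numFieldNormedType.Exports.

Local Open Scope classical_set_scope.
Local Open Scope ring_scope.

(* Vectors of R^d are represented by d.-tuple R, which carries the product
   (Borel) sigma-algebra. *)

Definition dotv (R : realType) (d : nat) (x y : d.-tuple R) : R :=
  \sum_(k < d) tnth x k * tnth y k.

Definition normv (R : realType) (d : nat) (x : d.-tuple R) : R :=
  Num.sqrt (dotv x x).

Definition addv (R : realType) (d : nat) (x y : d.-tuple R) : d.-tuple R :=
  [tuple tnth x k + tnth y k | k < d].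

Definition scalev (R : realType) (d : nat) (a : R) (x : d.-tuple R) :
    d.-tuple R :=
  [tuple a * tnth x k | k < d].

Definition mulmxv (R : realType) (d : nat) (H : 'M[R]_d) (x : d.-tuple R) :
    d.-tuple R :=
  [tuple \sum_(l < d) H k l * tnth x l | k < d].

Definition orthogonal_mx (R : realType) (d : nat) (H : 'M[R]_d) : Prop :=
  H^T *m H = 1%:M.

Definition spherically_symmetric (R : realType) (d : nat)
    (mu : probability (d.-tuple R) R) : Prop :=
  forall H : 'M[R]_d, orthogonal_mx H ->
  forall A : set (d.-tuple R), measurable A ->
    pushforward mu (mulmxv H) A = mu A.

(* The uniform distribution on the unit sphere is the unique rotation
   invariant probability measure carried by the sphere. *)
Definition uniform_on_sphere (R : realType) (d : nat)
    (mu : probability (d.-tuple R) R) : Prop :=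
  mu [set x | normv x = 1] = 1%E /\ spherically_symmetric mu.

Definition same_law (R : realType) (d : measure_display) (T : measurableType d)
    (mu nu : probability T R) : Prop :=
  forall A : set T, measurable A -> mu A = nu A.

(* Taking A i = setT for the indices outside a subfamily gives the product
   rule for every subfamily. *)
Definition mutually_independent (R : realType) (d d' : measure_display)
    (T : measurableType d) (T' : measurableType d') (P : probability T R)
    (n : nat) (X : 'I_n -> {RV P >-> T'}) : Prop :=
  forall A : 'I_n -> set T', (forall i, measurable (A i)) ->
    P (\bigcap_i (X i @^-1` A i)) = (\prod_(i < n) P (X i @^-1` A i))%E.

Definition sample (T T' : Type) (n : nat) (X : 'I_n -> T -> T') (w : T) :
    n.-tuple T' :=
  [tuple X i w | i < n].

Definition independent_samples (R : realType) (d d' : measure_display)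
    (T : measurableType d) (T' : measurableType d') (P : probability T R)
    (n : nat) (X U : 'I_n -> {RV P >-> T'}) : Prop :=
  forall A B : set (n.-tuple T'), measurable A -> measurable B ->
    P ((sample X @^-1` A) `&` (sample U @^-1` B)) =
    (P (sample X @^-1` A) * P (sample U @^-1` B))%E.

Definition theta (R : realType) (d : nat) (x y : d.-tuple R) : R :=
  expR (- (d%:R^-1 * dotv x y) ^+ 2).

Definition symm_variant (R : realType) (d : nat) (x u : d.-tuple R) :
    d.-tuple R :=
  scalev (normv x) u.

Definition signed_obs (R : realType) (d n : nat) (x u : n.-tuple (d.-tuple R))
    (s : bool) (i : 'I_n) : d.-tuple R :=
  addv (scalev s%:R (tnth x i))
       (scalev (1 - s%:R) (symm_variant (tnth x i) (tnth u i))).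

Definition path_cost (R : realType) (d n : nat) (x u : n.-tuple (d.-tuple R))
    (a : n.-tuple bool * 'S_n) : R :=
  \sum_(i < n) \sum_(j < n | j == i.+1 :> nat)
    theta (signed_obs x u (tnth a.1 (a.2 i)) (a.2 i))
          (signed_obs x u (tnth a.1 (a.2 j)) (a.2 j)).

Definition minimizer (R : realType) (d n : nat) (x u : n.-tuple (d.-tuple R)) :
    pred (n.-tuple bool * 'S_n) :=
  fun a => [forall b, path_cost x u a <= path_cost x u b].

(* (S, Pi) is drawn uniformly among the minimizers, with randomness independent
   of the data: given (X, U), its conditional law is uniform on the set of
   minimizers.  The formula integrates this conditional law over the events
   generated by (X, U). *)
Definition uniform_argmin (R : realType) (d0 : measure_display)
    (T : measurableType d0) (P : probability T R) (d n : nat)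
    (X U : 'I_n -> {RV P >-> d.-tuple R})
    (SPi : T -> n.-tuple bool * 'S_n) : Prop :=
  (forall a, measurable (SPi @^-1` [set a])) /\
  forall (B : set (n.-tuple (d.-tuple R) * n.-tuple (d.-tuple R)))
      (a : n.-tuple bool * 'S_n), measurable B ->
    let data w := (sample X w, sample U w) in
    let argmin w := minimizer (sample X w) (sample U w) in
    P ((data @^-1` B) `&` (SPi @^-1` [set a])) =
    (\int[P]_(w in data @^-1` B)
       ((a \in argmin w)%:R / #|argmin w|%:R)%:E)%E.

(* The probability space may change with the index d. *)
Definition cvg_in_probability (R : realType) (disp : nat -> measure_display)
    (Omega : forall d, measurableType (disp d))
    (Pr : forall d, probability (Omega d) R) (k : nat)
    (Z : forall d, Omega d -> k.-tuple R) (c : k.-tuple R) : Prop :=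
  forall eps : R, 0 < eps ->
    (fun d => Pr d [set w | eps < normv (addv (Z d w) (scalev (-1) c))])
      @ \oo --> 0%E.

Definition signs_vector (R : realType) (n : nat) (s : n.-tuple bool) :
    n.-tuple R :=
  [tuple (tnth s i)%:R | i < n].

Definition ones (R : realType) (n : nat) : n.-tuple R := [tuple 1 | i < n].

(* Main.v *)
(* Write cos(x, y) for the cosine of the angle between x and y.  By assumption,
   d cos(X_i, X_j)^2 exceeds any fixed M for all i <> j with probability tending
   to 1.  On the other hand, for a unit vector u uniform on the sphere and
   independent of y, rotation invariance gives E (y . u)^2 = |y|^2 / d, so
   d cos(X_i, U_j)^2 and d cos(U_i, U_j)^2 exceed M with probability at most 1/M
   by Markov's inequality.  Outside these finitely many bad events, every edge
   between two original observations is strictly cheaper than the same edge with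
   at least one end replaced by its spherical variant.  Since n >= 2, every
   vertex lies on an edge, so switching all signs to 1 along a fixed permutation
   strictly decreases the cost: all minimizers have the sign vector 1_n. *)

Require Import Defs.
From HB Require Import structures.
From mathcomp Require Import all_boot all_order all_algebra all_fingroup.
From mathcomp Require Import all_classical all_reals all_analysis.
From mathcomp Require Import measurable_realfun ring lra.

Set Implicit Arguments.
Unset Strict Implicit.
Unset Printing Implicit Defensive.

Import Order.TTheory GRing.Theory Num.Theory.
Import numFieldNormedType.Exports.

Local Open Scope classical_set_scope.
Local Open Scope ring_scope.

(** * Inner products and the Householder reflection *)

Section Vectors.
Context (R : realType) (d : nat).
Implicit Types (x y u : d.-tuple R).

Lemma dotvC x y : dotv x y = dotv y x.
Proof. by apply: eq_bigr => k _; rewrite mulrC. Qed.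

Lemma dotvZl a x y : dotv (scalev a x) y = a * dotv x y.
Proof.
by rewrite mulr_sumr; apply: eq_bigr => k _; rewrite tnth_mktuple mulrA.
Qed.

Lemma dotvZr a x y : dotv x (scalev a y) = a * dotv x y.
Proof. by rewrite dotvC dotvZl dotvC. Qed.

Lemma dotv_ge0 x : 0 <= dotv x x.
Proof. by apply: sumr_ge0 => k _; rewrite -expr2 sqr_ge0. Qed.

Lemma sqr_normv x : normv x ^+ 2 = dotv x x.
Proof. by rewrite sqr_sqrtr ?dotv_ge0. Qed.

Lemma dotvv_eq0 x : dotv x x = 0 -> x = [tuple 0 | k < d].
Proof.
move=> /eqP; rewrite psumr_eq0 => [/allP x0|k _]; last first.
  by rewrite -expr2 sqr_ge0.
apply: eq_from_tnth => k; rewrite tnth_mktuple.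
by apply/eqP; have := x0 k (mem_index_enum k); rewrite mulf_eq0 orbb.
Qed.

Lemma dotv0v y : dotv [tuple 0 | k < d] y = 0.
Proof. by rewrite /dotv big1// => k _; rewrite tnth_mktuple mul0r. Qed.

(* The Householder reflection exchanging [x] and [|x| e_k]. *)
Lemma orthogonal_row_exists x (k : 'I_d) :
  exists2 H : 'M[R]_d, orthogonal_mx H &
    forall u, normv x * tnth (mulmxv H u) k = dotv x u.
Proof.
have [v vE] : exists v : 'rV[R]_d,
    forall l, v 0 l = tnth x l - normv x * (l == k)%:R.
  by exists (\row_l (tnth x l - normv x * (l == k)%:R)) => l; rewrite mxE.
pose q := \sum_l v 0 l ^+ 2.
(* If [x] already equals [|x| e_k], then [q] is 0, so is [c], and the reflection degenerates to the
   identity. *)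
pose c := 2 / q.
have cE : c = 0 \/ c * q = 2.
  have [q0|q0] := eqVneq q 0; first by left; rewrite /c q0 invr0 mulr0.
  by right; rewrite /c divfK.
have vvT : v *m v^T = q%:M.
  apply/matrixP => i j; rewrite !ord1 !mxE eqxx mulr1n.
  by apply: eq_bigr => l _; rewrite !mxE expr2.
have qE : q = - 2 * normv x * v 0 k.
  rewrite /q vE eqxx mulr1.
  transitivity (\sum_l (tnth x l * tnth x l
      + (normv x ^+ 2 - 2 * normv x * tnth x l) * (l == k)%:R)).
    apply: eq_bigr => l _; rewrite vE.
    by case: (l == k) => /=; ring.
  rewrite big_split/= -/(dotv x x) -sqr_normv (bigD1 k)//= eqxx mulr1.
  rewrite [X in _ + (_ + X)]big1 => [|l /negbTE ->]; last by rewrite mulr0.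
  by ring.
have xE l : normv x * (l == k)%:R + v 0 l = tnth x l by rewrite vE; ring.
(* For nonzero [q], [c * q = 2] and [qE] give [|x| c v_k = -1]; otherwise [v] vanishes. Hence row
   [k] of the reflection, scaled by [|x|], is [|x| e_k + v], that is [x]. *)
have cv l : normv x * c * v 0 k * v 0 l = - v 0 l.
  have [q0|q0] := eqVneq q 0.
    suff -> : v 0 l = 0 by rewrite mulr0 oppr0.
    apply/eqP; rewrite -sqrf_eq0; move/eqP: q0.
    rewrite psumr_eq0 => [/allP/(_ l (mem_index_enum l))//|i _].
    exact: sqr_ge0.
  have -> : normv x * c * v 0 k = - 1.
    have : c * q = 2 by rewrite /c divfK.
    by rewrite qE => ?; lra.
  by rewrite mulN1r.
exists (1%:M - c *: (v^T *m v)).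
  rewrite /orthogonal_mx; set w := v^T *m v.
  have -> : (1%:M - c *: w)^T = 1%:M - c *: w.
    by apply/matrixP => i j; rewrite !mxE !big_ord1 !mxE [j == i]eq_sym; ring.
  have ww : w *m w = q *: w.
    by rewrite mulmxA -[v^T *m v *m _]mulmxA vvT mul_mx_scalar -scalemxAl.
  rewrite mulmxBl mul1mx mulmxBr mulmx1 -scalemxAl -scalemxAr ww.
  case: cE => [->|cq]; first by rewrite !scale0r !subr0.
  have -> : c *: (c *: (q *: w)) = c *: w + c *: w.
    by rewrite !scalerA -mulrA cq -scalerDl; congr (_ *: _); ring.
  by rewrite opprB addrK subrK.
move=> u; rewrite tnth_mktuple mulr_sumr; apply: eq_bigr => l _.
rewrite -xE mulrA; congr (_ * _); rewrite !mxE big_ord1 mxE.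
by rewrite [k == l]eq_sym mulrBr; congr (_ + _); rewrite -[RHS]opprK -cv; ring.
Qed.

End Vectors.

(** * Pathwise comparison of costs *)

Section DeterministicComparison.
Context (R : realType) (d n : nat).
Implicit Types (x u : n.-tuple (d.-tuple R)).

Lemma signed_obs_true x u i : signed_obs x u true i = tnth x i.
Proof.
apply: eq_from_tnth => k; rewrite !tnth_mktuple subrr mul0r addr0.
by rewrite mul1r.
Qed.

Lemma signed_obs_false x u i :
  signed_obs x u false i = scalev (normv (tnth x i)) (tnth u i).
Proof.
apply: eq_from_tnth => k; rewrite !tnth_mktuple subr0 mul1r mul0r.
by rewrite add0r.
Qed.

Lemma theta_lt (x y x' y' : d.-tuple R) : (0 < d)%N ->
  (theta x y < theta x' y') = (dotv x' y' ^+ 2 < dotv x y ^+ 2).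
Proof.
move=> d0; rewrite ltr_expR ltrN2 !exprMn ltr_pM2l// exprn_gt0//.
by rewrite invr_gt0 ltr0n.
Qed.

(** Indexing by edges lets a single edge be split off the cost. *)
Lemma path_costE x u a : path_cost x u a =
  \sum_(p : 'I_n * 'I_n | p.2 == p.1.+1 :> nat)
    theta (signed_obs x u (tnth a.1 (a.2 p.1)) (a.2 p.1))
          (signed_obs x u (tnth a.1 (a.2 p.2)) (a.2 p.2)).
Proof. by rewrite /path_cost pair_big_dep. Qed.

(** The edge leaving [k] works unless [k] is the last position; then the edge entering it does. *)
Lemma incident_edge (k : 'I_n) : (1 < n)%N ->
  exists2 p : 'I_n * 'I_n, p.2 == p.1.+1 :> nat & (p.1 == k) || (p.2 == k).
Proof.
move=> n1; have [kn|nk] := ltnP k.+1 n.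
  by exists (k, Ordinal kn); rewrite /= ?eqxx.
have kn : (k.-1 < n)%N by rewrite (leq_ltn_trans (leq_pred k)).
exists (Ordinal kn, k); rewrite /= ?eqxx ?orbT// prednK//.
by rewrite -ltnS (leq_trans n1).
Qed.

(** The competitor has all signs 1 and the same permutation: no edge gets dearer, and an edge at a
    vertex of sign 0 gets strictly cheaper. *)
Lemma minimizer_signs x u a : (1 < n)%N ->
  (forall i j s t, i != j -> ~~ (s && t) ->
    theta (tnth x i) (tnth x j) <
    theta (signed_obs x u s i) (signed_obs x u t j)) ->
  minimizer x u a -> a.1 = [tuple true | _ < n].
Proof.
move=> n1 sep /forallP/(_ ([tuple true | _ < n], a.2)).
apply: contraTeq => /= a1; rewrite -ltNge.
have [k /negbTE ak] : exists k, ~~ tnth a.1 k.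
  apply/existsP; apply: contraNT a1; rewrite negb_exists => /forallP a1.
  apply/eqP/eq_from_tnth => k; rewrite tnth_mktuple.
  by move: (a1 k); rewrite negbK => ->.
have edge_neq (p : 'I_n * 'I_n) : p.2 == p.1.+1 :> nat -> a.2 p.1 != a.2 p.2.
  move=> /eqP p12; rewrite (inj_eq perm_inj); apply/eqP => /(congr1 val)/=.
  by rewrite p12 => /eqP; rewrite ltn_eqF.
(* The inverse permutation gives the position at which the path visits the vertex [k] of sign 0. *)
have [p p12 pk] := incident_edge (a.2^-1%g k) n1.
rewrite !path_costE (bigD1 p)//= [ltRHS](bigD1 p)//=.
rewrite !tnth_mktuple !signed_obs_true; apply: ltr_leD.
  apply: sep; first exact: edge_neq.
  by case/orP: pk => /eqP ->; rewrite permKV ak ?andbF.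
apply: ler_sum => r /andP[r12 _]; rewrite !tnth_mktuple !signed_obs_true.
have [/andP[-> ->]|st] := boolP (tnth a.1 (a.2 r.1) && tnth a.1 (a.2 r.2)).
  by rewrite !signed_obs_true.
by apply/ltW/sep => //; exact: edge_neq.
Qed.

(* [aligned M (x, u)] is only used for unit vectors [u], where it says
   d cos(x, u)^2 > M. *)
Definition aligned (M : R) (p : d.-tuple R * d.-tuple R) : Prop :=
  M * dotv p.1 p.1 < d%:R * dotv p.1 p.2 ^+ 2.

Definition strongly_aligned (M : R) (p : d.-tuple R * d.-tuple R) : Prop :=
  M * (dotv p.1 p.1 * dotv p.2 p.2) < d%:R * dotv p.1 p.2 ^+ 2.

(* Both sides are false when [x] or [y] vanishes: the right-hand side is then
   [M < 0], as [x / 0 = 0]. *)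
Lemma strongly_aligned_ratio (M : R) (x y : d.-tuple R) : 0 < M ->
  strongly_aligned M (x, y) =
  (M < d%:R * dotv x y ^+ 2 / (normv x ^+ 2 * normv y ^+ 2)).
Proof.
move=> M0; rewrite /strongly_aligned/= !sqr_normv.
have [xy0|xy0] := eqVneq (dotv x x * dotv y y) 0.
  have -> : dotv x y = 0.
    move/eqP: xy0; rewrite mulf_eq0 => /orP[] /eqP /dotvv_eq0 ->.
      exact: dotv0v.
    by rewrite dotvC dotv0v.
  by rewrite xy0 expr0n !mulr0 mul0r ltxx ltNge (ltW M0).
by rewrite ltr_pdivlMr// lt_def xy0 mulr_ge0 ?dotv_ge0.
Qed.

(** After scaling by [d], the value [M |x_i|^2 |x_j|^2] separates the two squared inner products.
    The unit norm of [tnth u i] serves the case where both ends are replaced, as [aligned] is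
    normalised by its first vector only. *)
Lemma theta_signed_obs_lt (M : R) x u i j s t : (0 < d)%N ->
  strongly_aligned M (tnth x i, tnth x j) ->
  ~ aligned M (tnth x i, tnth u j) -> ~ aligned M (tnth x j, tnth u i) ->
  ~ aligned M (tnth u i, tnth u j) -> normv (tnth u i) = 1 ->
  ~~ (s && t) ->
  theta (tnth x i) (tnth x j) <
  theta (signed_obs x u s i) (signed_obs x u t j).
Proof.
move=> d0; rewrite /aligned /strongly_aligned/= => sxx.
move=> /negP; rewrite -leNgt => xu /negP; rewrite -leNgt => ux.
move=> /negP; rewrite -leNgt => uu ui1 st.
have d0' : 0 < d%:R :> R by rewrite ltr0n.
rewrite theta_lt// -(ltr_pM2l d0'); apply: le_lt_trans sxx.
case: s t st => -[]//= _; rewrite ?signed_obs_true ?signed_obs_false.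
- rewrite dotvZr exprMn sqr_normv mulrCA [M * _]mulrA [M * _ * _]mulrC.
  exact/ler_wpM2l/xu/dotv_ge0.
- rewrite dotvZl exprMn sqr_normv dotvC mulrCA [M * _]mulrCA.
  exact/ler_wpM2l/ux/dotv_ge0.
- rewrite dotvZl dotvZr mulrA exprMn exprMn !sqr_normv mulrCA [leRHS]mulrC.
  rewrite ler_wpM2l ?mulr_ge0 ?dotv_ge0//.
  by rewrite (le_trans uu)// -sqr_normv ui1 expr1n mulr1.
Qed.

End DeterministicComparison.

(** * Measurability of the alignment events *)

Section Measurability.
Context (R : realType) (d : nat) (disp : measure_display)
  (T : measurableType disp).
Implicit Types f g : T -> d.-tuple R.

Lemma measurable_coord f (k : 'I_d) :
  measurable_fun setT f -> measurable_fun setT (fun w => tnth (f w) k).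
Proof. by move=> mf; apply: measurableT_comp (measurable_tnth k) mf. Qed.

Lemma measurable_dotv f g : measurable_fun setT f -> measurable_fun setT g ->
  measurable_fun setT (fun w => dotv (f w) (g w)).
Proof.
move=> mf mg; apply: measurable_sum => k.
by apply: measurable_funM; exact: measurable_coord.
Qed.

Lemma measurable_aligned (M : R) f g :
  measurable_fun setT f -> measurable_fun setT g ->
  measurable [set w | aligned M (f w, g w)].
Proof.
move=> mf mg; rewrite -[X in measurable X]setTI.
apply: (@measurable_fun_ltr _ _ _ setT (fun w => M * dotv (f w) (f w))
  (fun w => d%:R * dotv (f w) (g w) ^+ 2) _ _ _ [set true]) => //.
- by apply: measurable_funM => //; exact: measurable_dotv.
- by apply: measurable_funM => //; apply/measurable_funX/measurable_dotv.
Qed.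

Lemma measurable_strongly_aligned (M : R) f g :
  measurable_fun setT f -> measurable_fun setT g ->
  measurable [set w | strongly_aligned M (f w, g w)].
Proof.
move=> mf mg; rewrite -[X in measurable X]setTI.
apply: (@measurable_fun_ltr _ _ _ setT
  (fun w => M * (dotv (f w) (f w) * dotv (g w) (g w)))
  (fun w => d%:R * dotv (f w) (g w) ^+ 2) _ _ _ [set true]) => //.
- by do !apply: measurable_funM => //; exact: measurable_dotv.
- by apply: measurable_funM => //; apply/measurable_funX/measurable_dotv.
Qed.

End Measurability.

Lemma measurable_mulmxv (R : realType) (d : nat) (H : 'M[R]_d) :
  measurable_fun setT (mulmxv H).
Proof.
apply/measurable_fun_tnthP => k.
rewrite (_ : _ \o _ = fun u => \sum_(l < d) H k l * tnth u l); last first.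
  by apply/funext => u /=; rewrite tnth_mktuple.
apply: measurable_sum => l; apply: measurable_funM => //.
exact: measurable_tnth.
Qed.

Lemma measurable_unit_sphere (R : realType) (d : nat) :
  measurable [set u : d.-tuple R | normv u = 1].
Proof.
rewrite (_ : [set _ | _] = (fun u : d.-tuple R => dotv u u) @^-1` [set 1]).
  rewrite -[X in measurable X]setTI.
  by apply: measurable_dotv => //; exact: measurable_id.
apply/seteqP; split => u /=; first by rewrite -sqr_normv => ->; rewrite expr1n.
by rewrite /normv => ->; rewrite sqrtr1.
Qed.

(** Change of variables through the pushforward, which agrees with [mu]; it is applied to
    rotations. *)
Lemma ge0_integral_invariant (R : realType) (disp : measure_display)
    (T : measurableType disp) (mu : {measure set T -> \bar R}) (phi : T -> T)
    (f : T -> \bar R) :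
  measurable_fun setT phi ->
  (forall A, measurable A -> pushforward mu phi A = mu A) ->
  measurable_fun setT f -> (forall x, 0 <= f x)%E ->
  (\int[mu]_x f (phi x) = \int[mu]_x f x)%E.
Proof.
move=> mphi muphi mf f0; pose phi' : {mfun T >-> T} := HB.pack phi
  (isMeasurableFun.Build _ _ _ _ _ mphi).
transitivity (\int[pushforward mu phi']_x f x)%E.
  by rewrite (ge0_integral_pushforward mphi).
by apply: eq_measure_integral => A mA _; exact: muphi.
Qed.

(** * Second moments and tails of a uniform direction *)

Section UniformOnSphere.
Context (R : realType) (d : nat) (mu : probability (d.-tuple R) R).
Hypothesis unif : uniform_on_sphere mu.
Local Open Scope ereal_scope.

(** A rotation turns [dotv x u] into [normv x] times coordinate [k] and preserves the law of [u].
    The index [k] stays free so that it can be summed over later. *)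
Lemma integral_sqr_dotv (x : d.-tuple R) (k : 'I_d) :
  \int[mu]_u (dotv x u ^+ 2)%:E =
  (normv x ^+ 2)%:E * \int[mu]_u (tnth u k ^+ 2)%:E.
Proof.
have [H oH Hx] := orthogonal_row_exists x k.
have mX : measurable_fun setT (fun u : d.-tuple R => (tnth u k ^+ 2)%:E).
  by apply/measurable_EFinP/measurable_funX/measurable_coord.
rewrite -(ge0_integral_invariant (measurable_mulmxv H) (unif.2 _ oH) mX);
  last by move=> u; rewrite lee_fin sqr_ge0.
rewrite -ge0_integralZl_EFin//.
- by apply: eq_integral => u _ /=; rewrite -EFinM -exprMn Hx.
- by move=> u _; rewrite lee_fin sqr_ge0.
- apply/measurable_EFinP/measurable_funX/measurable_coord.
  exact: measurable_mulmxv.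
- exact: sqr_ge0.
Qed.

(** The integrand is 1 almost everywhere, as [mu] is carried by the sphere. *)
Lemma integral_sqr_normv : \int[mu]_u (dotv u u)%:E = 1.
Proof.
have mS := @measurable_unit_sphere R d.
have S1 : mu (~` [set u | normv u = 1%R]) = 0.
  by rewrite probability_setC// unif.1 subee.
rewrite -[RHS](probability_setT mu) -(mul1e (mu setT)) -integral_cst//.
apply: ge0_ae_eq_integral => //.
- by apply/measurable_EFinP/measurable_dotv => //; exact: measurable_id.
- by move=> u _; rewrite lee_fin dotv_ge0.
exists (~` [set u | normv u = 1%R]); split => //; first exact: measurableC.
move=> u /= nu u1; apply: nu => _.
by rewrite -sqr_normv u1 expr1n.
Qed.

Lemma integral_sqr_dotv_sphere (x : d.-tuple R) :
  d%:R%:E * \int[mu]_u (dotv x u ^+ 2)%:E = (dotv x x)%:E.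
Proof.
have mX k : measurable_fun setT (fun u : d.-tuple R => (tnth u k ^+ 2)%:E).
  by apply/measurable_EFinP/measurable_funX/measurable_coord/measurable_id.
(* The [d] equal copies of the integral are expressed through the [d] different coordinates, whose
   squares add up to [|u|^2]. *)
transitivity (\sum_(k < d) ((normv x ^+ 2)%:E *
    \int[mu]_u (tnth u k ^+ 2)%:E)).
  rewrite (eq_bigr _ (fun k _ => esym (integral_sqr_dotv x k))).
  by rewrite sumr_const card_ord -[RHS]mule_natl.
rewrite -ge0_sume_distrr => [|k _]; last first.
  by apply: integral_ge0 => u _; rewrite lee_fin sqr_ge0.
rewrite -ge0_integral_sum// => [|k u _]; last by rewrite lee_fin sqr_ge0.
under eq_integral do rewrite sumEFin.
by rewrite integral_sqr_normv mule1 sqr_normv.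
Qed.

(** Markov's inequality for [d (x . u)^2], of mean [|x|^2], at level [M |x|^2]. For [x = 0] the
    event is empty because [aligned] is a strict inequality. *)
Lemma aligned_sphere_le (M : R) (x : d.-tuple R) : (0 < M)%R ->
  mu [set u | aligned M (x, u)] <= M^-1%:E.
Proof.
move=> M0; have [x0|x0] := eqVneq (dotv x x) 0%R.
  rewrite [X in mu X](_ : _ = set0) ?measure0 ?lee_fin ?invr_ge0 ?ltW//.
  apply/seteqP; split => // u; rewrite /aligned/= (dotvv_eq0 x0).
  by rewrite !dotv0v expr0n !mulr0 ltxx.
have q0 : (0 < dotv x x)%R by rewrite lt_def x0 dotv_ge0.
have mf : measurable_fun setT (fun u : d.-tuple R => dotv x u).
  by apply: measurable_dotv; [exact: measurable_cst|exact: measurable_id].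
pose g u : \bar R := (d%:R * dotv x u ^+ 2)%:E.
have mg : measurable_fun setT g.
  by apply/measurable_EFinP/measurable_funM => //; exact: measurable_funX.
have Ig : \int[mu]_u `|g u| = (dotv x x)%:E.
  rewrite -integral_sqr_dotv_sphere -ge0_integralZl_EFin//.
  - apply: eq_integral => u _; rewrite gee0_abs// lee_fin.
    by rewrite mulr_ge0// sqr_ge0.
  - by move=> u _; rewrite lee_fin sqr_ge0.
  - exact/measurable_EFinP/measurable_funX.
have Mq0 : (0 < M * dotv x x)%R by rewrite mulr_gt0.
have := le_integral_comp_abse mu measurableT (f := id)
  (@measurable_id _ _ _) (fun _ => id) (fun _ _ _ _ => id) mg Mq0.
rewrite Ig setTI => tail.
rewrite -(mul1r M^-1%R) -(divff x0) -mulrA -invfM [(_ * M)%R]mulrC EFinM.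
rewrite lee_pdivlMr//; apply: le_trans tail; rewrite muleC.
apply: lee_wpmul2l; first by rewrite lee_fin ltW.
apply: le_measure; rewrite ?inE.
- by apply: measurable_aligned; [exact: measurable_cst|exact: measurable_id].
- rewrite -[X in measurable X]setTI; apply: emeasurable_fun_c_infty => //.
  exact: measurableT_comp.
- move=> u; rewrite /aligned/= => /ltW Mu.
  by rewrite lee_fin (le_trans Mu)// ler_norm.
Qed.

End UniformOnSphere.

(** * Joint law of an independent pair *)

Section IndependentPair.
Context (R : realType) (d0 d : measure_display) (W : measurableType d0)
  (T : measurableType d) (P : probability W R) (mu nu : probability T R)
  (X Y : {RV P >-> T}).
Hypothesis indep : forall A B, measurable A -> measurable B ->
  P (X @^-1` A `&` Y @^-1` B) = (mu A * nu B)%E.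
Local Open Scope ereal_scope.

(** The joint law and the product measure agree on rectangles, which determine the product
    measure. *)
Lemma independent_pairE (C : set (T * T)) : measurable C ->
  P [set w | C (X w, Y w)] = (mu \x nu) C.
Proof.
move=> mC.
have mXY : measurable_fun setT (fun w => (X w, Y w)).
  by apply/measurable_fun_pair.
pose XY : {RV P >-> (T * T)%type} := HB.pack (fun w => (X w, Y w))
  (isMeasurableFun.Build _ _ _ _ _ mXY).
by rewrite (@product_measure_unique _ _ _ _ _ mu nu (distribution P XY)).
Qed.

(** Conditioning on the first coordinate: the product measure integrates the section bounds against
    a probability. *)
Lemma independent_pair_le (C : set (T * T)) (e : R) : measurable C ->
  (forall x, nu [set y | C (x, y)] <= e%:E) ->
  P [set w | C (X w, Y w)] <= e%:E.
Proof.
move=> mC Ce; rewrite independent_pairE// /product_measure1.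
have -> : e%:E = \int[mu]_x (cst e%:E x).
  by rewrite integral_cst//= probability_setT mule1.
apply: ge0_le_integral => //.
- exact: measurable_fun_xsection.
- move=> x _ /=; apply: le_trans (Ce x).
  rewrite (_ : xsection C x = [set y | C (x, y)])//.
  by apply/seteqP; split => y; rewrite /xsection/= inE.
Qed.

End IndependentPair.

Lemma measure_bigsetU_le (R : realType) (disp : measure_display)
    (T : measurableType disp) (mu : {measure set T -> \bar R})
    (I : Type) (s : seq I) (p : pred I) (F : I -> set T) :
  (forall i, measurable (F i)) ->
  (mu (\big[setU/set0]_(i <- s | p i) F i) <= \sum_(i <- s | p i) mu (F i))%E.
Proof.
move=> mF; elim: s => [|i s IHs]; first by rewrite !big_nil measure0.
rewrite !big_cons; case: ifP => // _.
apply: le_trans (measureU2 _ (mF i) _) _; last exact: leeD2l.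
by apply: bigsetU_measurable.
Qed.

(** Only the fibres of [SPi] are assumed measurable; every event about it is a finite union of
    fibres. *)
Lemma measurable_preimage_finType (disp : measure_display)
    (T : measurableType disp) (I : finType) (f : T -> I) :
  (forall a, measurable (f @^-1` [set a])) ->
  forall A : set I, measurable (f @^-1` A).
Proof.
move=> mf A; rewrite (_ : _ @^-1` _ = \bigcup_(a in A) f @^-1` [set a]).
  by apply: fin_bigcup_measurable => //; exact: finite_finset.
by apply/seteqP; split => [w Aw|w [a Aa /= ->//]]; exists (f w).
Qed.

(** The bound with [e = 1] makes [f] eventually finite, which reduces the claim to real numbers. *)
Lemma ge0_cvge0 (R : realType) (f : nat -> \bar R) :
  (forall d, 0 <= f d)%E ->
  (forall e : R, 0 < e -> \forall d \near \oo, (f d <= e%:E)%E) ->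
  f @ \oo --> 0%E.
Proof.
move=> f0 fe.
have ffin d (e : R) : (f d <= e%:E)%E -> f d \is a fin_num.
  by move=> fd; rewrite ge0_fin_numE// (le_lt_trans fd) ?ltry.
apply/fine_cvgP; split.
  by apply: filterS (fe 1 ltr01) => d; exact: ffin.
apply/cvgr0Pnorm_le => e e0; apply: filterS (fe e e0) => d fd.
by rewrite /= ger0_norm ?fine_ge0// -lee_fin fineK// (ffin _ _ fd).
Qed.

(** * Probability of a wrong sign in a fixed dimension *)

Section GivenDimension.
Context (R : realType) (n d : nat) (disp : measure_display)
  (Omega : measurableType disp) (Pr : probability Omega R)
  (P : probability (d.-tuple R) R)
  (X U : 'I_n -> {RV Pr >-> d.-tuple R}).
Hypotheses (d0 : (0 < d)%N) (n1 : (1 < n)%N).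
Hypothesis Xlaw : forall i, same_law (distribution Pr (X i)) P.
Hypothesis Xind : mutually_independent X.
Hypothesis Ulaw : forall i, uniform_on_sphere (distribution Pr (U i)).
Hypothesis Uind : mutually_independent U.
Hypothesis XU : independent_samples X U.
Local Open Scope ereal_scope.

(** Mutual independence is applied to sets equal to the whole space off [i] and [j], which
    contribute factors 1. *)
Lemma pair_independent (Z : 'I_n -> {RV Pr >-> d.-tuple R}) i j A B :
  mutually_independent Z -> i != j -> measurable A -> measurable B ->
  Pr (Z i @^-1` A `&` Z j @^-1` B) =
  distribution Pr (Z i) A * distribution Pr (Z j) B.
Proof.
move=> Zind ij mA mB.
pose C k := if k == i then A else if k == j then B else setT.
have ji : (j == i) = false by rewrite eq_sym (negbTE ij).
have mC k : measurable (C k) by rewrite /C; case: ifP => // _; case: ifP.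
have := Zind C mC.
have -> : \bigcap_k (Z k @^-1` C k) = Z i @^-1` A `&` Z j @^-1` B.
  apply/seteqP; split => w /=.
    by move=> CZ; split; [have := CZ i I|have := CZ j I]; rewrite /C/= eqxx ?ji.
  move=> [Aw Bw] k _; rewrite /C/=.
  by have [->//|_] := eqVneq k i; have [->//|_] := eqVneq k j.
move=> ->; rewrite (bigD1 i)//= (bigD1 j) ?ji//=.
rewrite big1 ?mule1 /C ?eqxx ?ji// => k /andP[/negbTE -> /negbTE ->].
by rewrite preimage_setT probability_setT.
Qed.

Lemma signal_noise_independent i j A B : measurable A -> measurable B ->
  Pr (X i @^-1` A `&` U j @^-1` B) =
  distribution Pr (X i) A * distribution Pr (U j) B.
Proof.
move=> mA mB.
have coord k (C : set (d.-tuple R)) : measurable C ->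
    measurable [set z : n.-tuple (d.-tuple R) | C (tnth z k)].
  by move=> mC; rewrite -[X in measurable X]setTI; exact: measurable_tnth.
have := XU (coord i A mA) (coord j B mB).
have sampleE (Z : 'I_n -> {RV Pr >-> d.-tuple R}) k C :
    sample Z @^-1` [set z : n.-tuple (d.-tuple R) | C (tnth z k)] =
    Z k @^-1` C.
  by apply/seteqP; split => w /=; rewrite tnth_mktuple.
by rewrite !sampleE.
Qed.

(** Both pairs have law [P \x P]. This carries the assumption on the first two observations over to
    every pair. *)
Lemma strongly_aligned_exchangeable (M : R) i j i' j' : i != j -> i' != j' ->
  Pr [set w | strongly_aligned M (X i w, X j w)] =
  Pr [set w | strongly_aligned M (X i' w, X j' w)].
Proof.
move=> ij ij'.
have mS : measurable [set p : d.-tuple R * d.-tuple R | strongly_aligned M p].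
  rewrite (_ : [set _ | _] = [set p | strongly_aligned M (p.1, p.2)]).
    by apply: measurable_strongly_aligned.
  by apply/seteqP; split => -[].
have indep k l : k != l -> forall A B, measurable A -> measurable B ->
    Pr (X k @^-1` A `&` X l @^-1` B) = P A * P B.
  move=> kl A B mA mB; rewrite pair_independent//.
  by congr (_ * _); exact: Xlaw.
by rewrite (independent_pairE (indep _ _ ij) mS)
  (independent_pairE (indep _ _ ij') mS).
Qed.

(** The tail bound on the sphere holds conditionally on [Z], which stands for an observation or for
    another direction. *)
Lemma aligned_noise_le (Z : {RV Pr >-> d.-tuple R}) j (M : R) : (0 < M)%R ->
  (forall A B, measurable A -> measurable B ->
    Pr (Z @^-1` A `&` U j @^-1` B) =
    distribution Pr Z A * distribution Pr (U j) B) ->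
  Pr [set w | aligned M (Z w, U j w)] <= M^-1%:E.
Proof.
move=> M0 indep.
apply: (independent_pair_le indep (C := [set p | aligned M p])) => [|x].
  rewrite (_ : [set _ | _] = [set p | aligned M (p.1, p.2)]).
    by apply: measurable_aligned.
  by apply/seteqP; split => -[].
exact: aligned_sphere_le (Ulaw j) _ _ M0.
Qed.

(** The four pieces negate hypotheses of [theta_signed_obs_lt]. This is a set of data rather than of
    outcomes, because [uniform_argmin] conditions on sets of data. *)
Definition bad_pair (M : R) (q : 'I_n * 'I_n) :
    set (n.-tuple (d.-tuple R) * n.-tuple (d.-tuple R)) :=
  ~` [set z | strongly_aligned M (tnth z.1 q.1, tnth z.1 q.2)] `|`
  [set z | aligned M (tnth z.1 q.1, tnth z.2 q.2)] `|`
  [set z | aligned M (tnth z.2 q.1, tnth z.2 q.2)] `|`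
  ~` [set z | normv (tnth z.2 q.1) = 1%R].

Definition bad_data (M : R) :=
  \big[setU/set0]_(q : 'I_n * 'I_n | q.1 != q.2) bad_pair M q.

Lemma measurable_bad_pair M q : measurable (bad_pair M q).
Proof.
have mf k : measurable_fun setT
    (fun z : n.-tuple (d.-tuple R) * n.-tuple (d.-tuple R) => tnth z.1 k).
  exact: (measurableT_comp (measurable_tnth k) measurable_fst).
have mg k : measurable_fun setT
    (fun z : n.-tuple (d.-tuple R) * n.-tuple (d.-tuple R) => tnth z.2 k).
  exact: (measurableT_comp (measurable_tnth k) measurable_snd).
apply: measurableU; first (apply: measurableU; first apply: measurableU).
- by apply: measurableC; exact: measurable_strongly_aligned.
- exact: measurable_aligned.
- exact: measurable_aligned.
apply: measurableC.
rewrite -[X in measurable X]setTI.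
exact: mg q.1 measurableT _ (@measurable_unit_sphere R d).
Qed.

Lemma measurable_bad_data M : measurable (bad_data M).
Proof. by apply: bigsetU_measurable => q _; exact: measurable_bad_pair. Qed.

Lemma minimizer_off_bad_data M z a : ~ bad_data M z ->
  minimizer z.1 z.2 a -> a.1 = [tuple true | _ < n].
Proof.
move=> zM; apply: minimizer_signs => // i j s t ij.
have good q : q.1 != q.2 -> ~ bad_pair M q z.
  by move=> qij zq; apply: zM; rewrite /bad_data -bigcup_seq_cond/=; exists q;
    rewrite //= mem_index_enum.
have ji : j != i by rewrite eq_sym.
(* The reversed pair controls the remaining mixed product, [x_j] against [u_i]. *)
move: (good (i, j) ij) (good (j, i) ji); rewrite /bad_pair/=.
move=> /not_orP[/not_orP[/not_orP[/contrapT Sij Aij] Uij] /contrapT Ni].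
move=> /not_orP[/not_orP[/not_orP[_ Aji] _] _].
exact: theta_signed_obs_lt Sij Aij Aji Uij Ni.
Qed.

(** The budget is [e] for the two observations, [M^-1] for each of the two noise alignments, and 0
    for leaving the sphere. *)
Lemma bad_pair_le (M e : R) q i j : (0 < M)%R -> i != j -> q.1 != q.2 ->
  (1 - e)%:E <= Pr [set w | strongly_aligned M (X i w, X j w)] ->
  Pr [set w | bad_pair M q (sample X w, sample U w)] <= (e + M^-1 + M^-1)%:E.
Proof.
move=> M0 ij q12 He; case: q q12 => k l /= kl.
pose A := [set w | strongly_aligned M (X k w, X l w)].
pose B := [set w | aligned M (X k w, U l w)].
pose C := [set w | aligned M (U k w, U l w)].
pose D := [set w | normv (U k w) = 1%R].
have -> : [set w | bad_pair M (k, l) (sample X w, sample U w)] =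
    ~` A `|` B `|` C `|` ~` D.
  by apply/seteqP; split => w; rewrite /bad_pair/= !tnth_mktuple.
have mA : measurable A by apply: measurable_strongly_aligned.
have mB : measurable B by apply: measurable_aligned.
have mC : measurable C by apply: measurable_aligned.
have mD : measurable D.
  rewrite -[D]setTI.
  exact: (measurable_funPT (U k)) measurableT _ (@measurable_unit_sphere R d).
have PA : Pr (~` A) <= e%:E.
  rewrite probability_setC// (strongly_aligned_exchangeable M kl ij).
  rewrite leeBlDr; first by rewrite -leeBlDl// -EFinB.
  by apply/fin_num_measure/measurable_strongly_aligned.
have PB : Pr B <= M^-1%:E.
  by apply: aligned_noise_le => // *; exact: signal_noise_independent.
have PC : Pr C <= M^-1%:E.
  by apply: aligned_noise_le => // *; exact: pair_independent.
have PD : Pr (~` D) <= 0.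
  by rewrite probability_setC// [X in _ - X](Ulaw k).1 subee.
apply: (le_trans (measureU2 _ _ _)); [|exact: measurableC|].
  by do !apply: measurableU => //; exact: measurableC.
rewrite !EFinD -[leRHS]adde0; apply: leeD => //.
apply: (le_trans (measureU2 _ _ _)) => //.
  by apply: measurableU => //; exact: measurableC.
apply: leeD => //; apply: (le_trans (measureU2 _ _ _)) => //.
  exact: measurableC.
exact: leeD.
Qed.

(** Either the data are bad, which a union bound over pairs controls, or they are good and a wrong
    sign vector has conditional probability 0. *)
Lemma wrong_signs_le (M e : R) i j (SPi : Omega -> n.-tuple bool * 'S_n) :
  uniform_argmin X U SPi -> (0 < M)%R -> (0 <= e)%R -> i != j ->
  (1 - e)%:E <= Pr [set w | strongly_aligned M (X i w, X j w)] ->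
  Pr [set w | (SPi w).1 != [tuple true | _ < n]] <=
    ((e + M^-1 + M^-1) *+ #|{: 'I_n * 'I_n}|)%:E.
Proof.
move=> [mSPi SPiE] M0 e0 ij He.
pose data w := (sample X w, sample U w).
have mdata : measurable_fun setT data.
  apply: measurable_fun_pair; apply/measurable_fun_tnthP => k.
    by rewrite (_ : _ \o _ = X k)//; apply/funext => w /=; rewrite tnth_mktuple.
  by rewrite (_ : _ \o _ = U k)//; apply/funext => w /=; rewrite tnth_mktuple.
have mbad : measurable (data @^-1` bad_data M).
  by rewrite -[X in measurable X]setTI; apply: mdata => //;
    exact: measurable_bad_data.
pose wrong a := data @^-1` (~` bad_data M) `&` SPi @^-1` [set a].
have mwrong a : measurable (wrong a).
  by apply: measurableI => //; rewrite preimage_setC; exact: measurableC.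
pose bad_signs := [pred a : n.-tuple bool * 'S_n | a.1 != [tuple true | _ < n]].
(* The conditional law of [SPi] charges minimizers only. *)
have wrong0 a : bad_signs a -> Pr (wrong a) = 0.
  move=> /= a1; rewrite /wrong SPiE; last first.
    by apply: measurableC; exact: measurable_bad_data.
  apply: integral0_eq => w /= wM; rewrite [a \in _](_ : _ = false) ?mul0r//.
  apply/negbTE; apply: contra a1 => amin; apply/eqP.
  exact: (@minimizer_off_bad_data M (data w)).
have sub : [set w | (SPi w).1 != [tuple true | _ < n]] `<=`
    data @^-1` bad_data M `|` \big[setU/set0]_(a | bad_signs a) wrong a.
  move=> w /= Sw; have [zM|zM] := pselect (bad_data M (data w)); first by left.
  right; rewrite -bigcup_seq_cond/=; exists (SPi w); rewrite //=.
  by rewrite mem_index_enum.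
have mbigw : measurable (\big[setU/set0]_(a | bad_signs a) wrong a).
  exact: bigsetU_measurable.
apply: (@le_trans _ _ (Pr (data @^-1` bad_data M `|`
    \big[setU/set0]_(a | bad_signs a) wrong a))).
  apply: le_measure; rewrite ?inE//; last exact: measurableU.
  exact: (measurable_preimage_finType mSPi
    [set a | a.1 != [tuple true | _ < n]]).
apply: le_trans (measureU2 _ mbad mbigw) _.
rewrite -[leRHS]adde0; apply: leeD; last first.
  apply: le_trans (measure_bigsetU_le _ _ _ mwrong) _.
  by rewrite big1// => a /wrong0.
rewrite (_ : data @^-1` _ =
    \big[setU/set0]_(q : 'I_n * 'I_n | q.1 != q.2) data @^-1` bad_pair M q);
  last first.
  by rewrite /bad_data -!bigcup_seq_cond preimage_bigcup.
apply: le_trans (measure_bigsetU_le _ _ _ _) _.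
  by move=> q; rewrite -[X in measurable X]setTI; apply: mdata => //;
    exact: measurable_bad_pair.
have c0 : (0 <= e + M^-1 + M^-1)%R by rewrite !addr_ge0// invr_ge0 ltW.
(* Diagonal pairs are added to obtain a plain count; their terms are nonnegative since [0 <= e]. *)
apply: (@le_trans _ _ (\sum_(q : 'I_n * 'I_n) (e + M^-1 + M^-1)%:E)).
  rewrite big_mkcond/=; apply: lee_sum => q _; case: ifPn => [q12|_].
    exact: bad_pair_le He.
  by rewrite lee_fin.
by rewrite sumEFin sumr_const.
Qed.

End GivenDimension.

(** * Passage to the limit in the dimension *)

Theorem theorem3p2 (R : realType) (n : nat) (hn : (1 < n)%N)
    (disp : nat -> measure_display)
    (Omega : forall d : nat, measurableType (disp d))
    (Pr : forall d : nat, probability (Omega d) R)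
    (P : forall d : nat, probability (d.-tuple R) R)
    (X U : forall d : nat, 'I_n -> {RV (Pr d) >-> d.-tuple R})
    (SPi : forall d : nat, Omega d -> n.-tuple bool * 'S_n)
    (hP : forall d : nat, (2 <= d)%N -> ~ spherically_symmetric (P d))
    (hXlaw : forall d : nat, (2 <= d)%N ->
      forall i : 'I_n, same_law (distribution (Pr d) (X d i)) (P d))
    (hXind : forall d : nat, (2 <= d)%N -> mutually_independent (X d))
    (hUlaw : forall d : nat, (2 <= d)%N ->
      forall i : 'I_n, uniform_on_sphere (distribution (Pr d) (U d i)))
    (hUind : forall d : nat, (2 <= d)%N -> mutually_independent (U d))
    (hXU : forall d : nat, (2 <= d)%N -> independent_samples (X d) (U d))
    (hSPi : forall d : nat, (2 <= d)%N -> uniform_argmin (X d) (U d) (SPi d))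
    (hlim : forall M : R, 0 < M ->
      (fun d : nat => Pr d [set w |
        let x1 := X d (Ordinal (ltnW hn)) w in
        let x2 := X d (Ordinal hn) w in
        M < d%:R * dotv x1 x2 ^+ 2 / (normv x1 ^+ 2 * normv x2 ^+ 2)])
      @ \oo --> 1%E) :
  cvg_in_probability Pr (fun d w => signs_vector R (SPi d w).1) (ones R n).
Proof.
move=> eps eps0; apply: ge0_cvge0 => [d|delta delta0]; first exact: measure_ge0.
pose m := #|{: 'I_n * 'I_n}|.
(* With [M = e^-1] each pair costs at most [3 e], so all [m] pairs cost [delta * m / m.+1], which is
   at most [delta]. *)
pose e := delta / 3 / m.+1%:R.
have e0 : 0 < e by rewrite !divr_gt0.
have ie0 : 0 < e^-1 by rewrite invr_gt0.
pose i0 := Ordinal (ltnW hn); pose i1 := Ordinal hn.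
have /fine_cvgP[pfin /cvgrPdist_le/(_ e e0) pe] := hlim _ ie0.
near=> d.
have d2 : (2 <= d)%N by near: d; exact: nbhs_infty_ge.
have d0 : (0 < d)%N by exact: ltnW.
have He : ((1 - e)%:E <=
    Pr d [set w | strongly_aligned e^-1 (X d i0 w, X d i1 w)])%E.
  have -> : [set w | strongly_aligned e^-1 (X d i0 w, X d i1 w)] =
      [set w | e^-1 < d%:R * dotv (X d i0 w) (X d i1 w) ^+ 2 /
        (normv (X d i0 w) ^+ 2 * normv (X d i1 w) ^+ 2)].
    by apply/funext => w /=; rewrite strongly_aligned_ratio.
  have pd : `|1 - fine (Pr d [set w |
      let x1 := X d i0 w in let x2 := X d i1 w in
      e^-1 < d%:R * dotv x1 x2 ^+ 2 / (normv x1 ^+ 2 * normv x2 ^+ 2)])| <= e.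
    by near: d.
  have pfd : Pr d [set w |
      let x1 := X d i0 w in let x2 := X d i1 w in
      (e^-1 < d%:R * dotv x1 x2 ^+ 2 / (normv x1 ^+ 2 * normv x2 ^+ 2))%R]
      \is a fin_num.
    by near: d.
  rewrite -(fineK pfd) lee_fin lerBlDr -lerBlDl.
  exact: le_trans (ler_norm _) pd.
have := wrong_signs_le d0 hn (hXlaw d d2) (hXind d d2) (hUlaw d d2)
  (hUind d d2) (hXU d d2) (hSPi d d2) ie0 (ltW e0) (isT : i0 != i1) He.
rewrite invrK => wrong_le; have [mSPi _] := hSPi d d2.
apply: (@le_trans _ _ (Pr d [set w | (SPi d w).1 != [tuple true | _ < n]])).
  apply: le_measure; rewrite ?inE.
  - exact: (measurable_preimage_finType mSPi [set a | eps < normv (Defs.addv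
      (signs_vector R a.1) (scalev (-1) (ones R n)))]).
  - exact: (measurable_preimage_finType mSPi
      [set a | a.1 != [tuple true | _ < n]]).
  (* If all signs are 1, the deviation is the zero vector, whose norm does not exceed [eps]. *)
  move=> w /=; apply: contraTN => /eqP ->.
  rewrite -leNgt (_ : Defs.addv _ _ = [tuple 0 | k < n]).
    by rewrite /normv dotv0v sqrtr0 ltW.
  by apply: eq_from_tnth => k; rewrite !tnth_mktuple mulN1r subrr.
apply: le_trans wrong_le _; rewrite lee_fin.
have -> : (e + e + e) *+ m = delta * (m%:R / m.+1%:R).
  by rewrite -mulr_natr /e; field.
by apply: ler_piMr; [exact: ltW|rewrite ler_pdivrMr// mul1r ler_nat].
Unshelve. all: by end_near.
Qed.
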